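(* Let $d\ge 2$ be an integer. Then there exists an integer $r_0\ge d$ such that for all integers $r\ge r_0$, $$\frac{(r+d-1)^{\underline{d}}-r^d}{r^{\underline{d}}}\binom{2d-1}{d}d^d<\left(\frac{r^d}{r^{\underline{d}}}-\frac{r^{\underline{d}}}{r^d}\right)\binom{2d-1}{d}d^d.$$
   Context: For an integer $d\ge 0$, $t^{\underline{d}}:=t(t-1)(t-2)\cdots(t-d+1)$ denotes the falling factorial. *)

(* Defs.v *)
From mathcomp Require Import all_boot all_order all_algebra.
Set Implicit Arguments.
Unset Strict Implicit.
Unset Printing Implicit Defensive.

(* Main.v *)
(** Write [F = r (r-1) ... (r-d+1)], [U = r (r+1) ... (r+d-1)] and [P = r ^ d].
    After clearing denominators the claim is [F ^ 2 + U P < 2 P ^ 2].  Pairing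
    [(r - i) (r + i) <= r ^ 2] gives [U F <= P ^ 2], so for [f = F / P] it is
    enough that [f ^ 2 + 1 / f < 2], i.e. [(1 - f) (1 - f - f ^ 2) < 0].  This
    holds for [2 / 3 <= f < 1], and [f >= 1 - d ^ 2 / r] by Bernoulli, so
    [r >= 3 d ^ 2] suffices. *)
Require Import Defs.
From mathcomp Require Import all_boot all_order all_algebra.
From mathcomp Require Import zify ring lra.
Import Order.TTheory GRing.Theory Num.Theory.
Local Open Scope ring_scope.

Lemma ffact_leq_exp (n m : nat) : (n ^_ m <= n ^ m)%N.
Proof.
elim: m => [|m IHm]; first by rewrite ffactn0.
by rewrite ffactnSr expnSr leq_mul // leq_subr.
Qed.

(** Strictness comes from the factor [n - 1], present once [m] is at least 2; later factors only
    preserve it. *)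
Lemma ffact_ltn_exp (n m : nat) : (0 < n)%N -> (1 < m)%N -> (n ^_ m < n ^ m)%N.
Proof.
move=> n_gt0; case: m => [|[|m]] // _; elim: m => [|m IHm].
  by rewrite ffactnSr ffactn1 expnS expn1 ltn_pmul2l // ltn_subrL n_gt0.
rewrite ffactnSr expnSr (leq_ltn_trans (n := n ^_ m.+2 * n)) //.
  by rewrite leq_mul // leq_subr.
by rewrite ltn_pmul2r.
Qed.

(** Denominator-free form of [f >= 1 - m ^ 2 / n]. The new factor [1 - m / n] costs at most [m / n]
    because [f <= 1], and [m ^ 2 + m <= (m + 1) ^ 2]. *)
Lemma ffact_Bernoulli (n m : nat) :
  (n ^ m * n <= n * n ^_ m + m * m * n ^ m)%N.
Proof.
elim: m => [|m IHm]; first by rewrite ffactn0 expn0; lia.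
have := ffact_leq_exp n m; rewrite ffactnSr expnSr.
move: (n ^_ m)%N (n ^ m)%N IHm => F P IHm leFP.
have le_n : (n <= n - m + m)%N by lia.
have h1 : (n * (P * n) <= n * (n * F + m * m * P))%N by rewrite leq_mul2l IHm orbT.
have h2 : (n * F * n <= n * F * (n - m + m))%N by rewrite leq_mul2l le_n orbT.
have h3 : (n * m * F <= n * m * P)%N by rewrite leq_mul2l leFP orbT.
nia.
Qed.

Lemma rising_ffactE (n m : nat) :
  ((n + m - 1) ^_ m = \prod_(i < m) (n + i))%N.
Proof.
rewrite ffact_prod (reindex_inj rev_ord_inj) /=.
by apply: eq_bigr => i _; have := ltn_ord i; lia.
Qed.

Lemma rising_mul_ffact_leq (n m : nat) :
  ((n + m - 1) ^_ m * n ^_ m <= n ^ m * n ^ m)%N.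
Proof.
rewrite rising_ffactE ffact_prod -big_split -expnMn /=.
rewrite -[m in leqRHS]card_ord -prod_nat_const.
(* [subn_sqr] holds for truncated subtraction, so [i > n] needs no separate case. *)
apply: leq_prod => i _; rewrite mulnC -subn_sqr -mulnn; exact: leq_subr.
Qed.

Lemma rising_ffact_ratio_lt (R : realFieldType) (F U P : R) :
    0 < F -> F < P -> 2 * P <= 3 * F -> U * F <= P * P ->
  (U - P) / F < P / F - F / P.
Proof.
move=> F_gt0 ltFP le23 leUF; have P_gt0 : 0 < P by lra.
(* With [f >= 2 / 3], [f ^ 2 + f >= 10 / 9 > 1]. *)
have key : P ^+ 2 < F ^+ 2 + F * P by nra.
have cubic : P ^+ 3 + F ^+ 3 < 2 * F * P ^+ 2.
  have : 0 < (P - F) * (F ^+ 2 + F * P - P ^+ 2) by rewrite mulr_gt0 ?subr_gt0.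
  by lra.
rewrite -subr_gt0.
(* The extra factor [F] in the denominator makes [U * F] appear, so its bound applies. *)
have -> : P / F - F / P - (U - P) / F =
    (2 * F * P ^+ 2 - U * F * P - F ^+ 3) / (F ^+ 2 * P).
  by field; rewrite !gt_eqF.
rewrite divr_gt0 ?mulr_gt0 ?exprn_gt0 //.
have : U * F * P <= P * P * P by rewrite ler_pM2r.
by lra.
Qed.

Theorem lemma2 (d : nat) (hd : (2 <= d)%N) :
  exists r0 : nat, (d <= r0)%N /\
    forall r : nat, (r0 <= r)%N ->
      (((r + d - 1) ^_ d)%N%:R - r%:R ^+ d) / (r ^_ d)%N%:R
        * 'C(2 * d - 1, d)%:R * d%:R ^+ d
      < (r%:R ^+ d / (r ^_ d)%N%:R - (r ^_ d)%N%:R / r%:R ^+ d)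
        * 'C(2 * d - 1, d)%:R * d%:R ^+ d :> rat.
Proof.
exists (3 * (d * d))%N; split=> [|r le_r]; first by nia.
have le_dr : (d <= r)%N by nia.
have r_gt0 : (0 < r)%N by lia.
have d_gt0 : 0 < (d%:R : rat) by rewrite ltr0n ltnW.
have bin_pos : 0 < ('C(2 * d - 1, d)%:R : rat) by rewrite ltr0n bin_gt0; lia.
rewrite (ltr_pM2r (exprn_gt0 d d_gt0)) (ltr_pM2r bin_pos).
rewrite -natrX; apply: rising_ffact_ratio_lt.
- by rewrite ltr0n ffact_gt0.
- by rewrite ltr_nat ffact_ltn_exp.
(* After scaling by [r], the Bernoulli loss [d * d * r ^ d] is at most a third of [r * r ^ d]. *)
- rewrite -!natrM ler_nat -(leq_pmul2l r_gt0).
  have := ffact_Bernoulli r d.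
  have : (3 * (d * d) * r ^ d <= r * r ^ d)%N by rewrite leq_mul2r le_r orbT.
  by move: (r ^ d)%N (r ^_ d)%N => P F; nia.
- by rewrite -!natrM ler_nat rising_mul_ffact_leq.
Qed.
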